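(* Let $D\subseteq[n]^2$ and $\alpha=(\alpha_1,\dots,\alpha_n)\in\mathbb{Z}_{\ge0}^n$. Then $\alpha\in\mathcal{S}_D$ if and only if $\mathsf{PerfectTab}(D,\alpha)\neq\emptyset$.
   Context: $D\subseteq[n]^2$ is viewed as a set of boxes in an $n\times n$ grid, $(r,c)$ being the box in row $r$ from the top and column $c$ from the left. Schubitope $\mathcal{S}_D$: given $S\subseteq[n]$ and a column $c\in[n]$, form a string $\mathsf{word}_{c,S}(D)$ by reading column $c$ from top to bottom ($r=1,\dots,n$) and recording ''$($'' if $(r,c)\notin D$ and $r\in S$; ''$)$'' if $(r,c)\in D$ and $r\notin S$; ''$\star$'' if $(r,c)\in D$ and $r\in S$ (and nothing otherwise). Let $\theta_D^c(S)$ be the number of $\star$'s in $\mathsf{word}_{c,S}(D)$ plus the number of matched pairs $()$ in it, using the standard inside-out matching of parentheses (ignoring $\star$'s), and let $\theta_D(S)=\sum_{c=1}^n\theta_D^c(S)$. Then $$\mathcal{S}_D=\Big\{(\alpha_1,\dots,\alpha_n)\in\mathbb{R}_{\ge0}^n:\ \alpha_1+\dots+\alpha_n=\#D\ \text{ and }\ \sum_{i\in S}\alpha_i\le\theta_D(S)\text{ for all }S\subseteq[n]\Big\}.$$ $\mathsf{PerfectTab}(D,\alpha)$ is the set of maps $\tau:D\to[n]$ such that $\tau(r,c)\le r$ for all $(r,c)\in D$ (flagged), $\tau(r,c)\neq\tau(r',c)$ whenever $r\neq r'$ (column-injective), and $\#\tau^{-1}(\{i\})=\alpha_i$ for each $i\in[n]$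 (content $\alpha$). *)

(* Defs.v *)
From mathcomp Require Import all_boot all_order all_algebra.
From mathcomp Require Import boolp classical_sets reals.

Set Implicit Arguments.
Unset Strict Implicit.
Unset Printing Implicit Defensive.

Import Order.TTheory GRing.Theory Num.Theory.

(* The index set [n] = {1, ..., n} is rendered as 'I_n = {0, ..., n-1}: all
   rows, columns and tableau entries are shifted down by one.  A box is a pair
   (row, column), row 0 being the top row. *)

Inductive letter := LParen | RParen | Star.

Definition is_star (l : letter) : bool := if l is Star then true else false.

(* [enum 'I_n] lists the rows in increasing order, i.e. from top to bottom. *)
Definition word (n : nat) (D : {set 'I_n * 'I_n}) (c : 'I_n) (S : {set 'I_n}) :
    seq letter :=
  pmap (fun r : 'I_n =>
          match (r, c) \in D, r \in S with
          | false, true => Some LParen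
          | true, false => Some RParen
          | true, true => Some Star
          | false, false => None
          end)
       (enum 'I_n).

(* Inside-out matching: each right parenthesis is matched with the closest
   still unmatched left parenthesis before it, if any.  [k] is the position of
   the first letter of [w] in the whole word, [opened] the stack of positions of
   the unmatched left parentheses already read (most recent first); the result
   is the list of matched pairs of positions. *)
Fixpoint matching_from (k : nat) (opened : seq nat) (w : seq letter) :
    seq (nat * nat) :=
  match w with
  | [::] => [::]
  | Star :: w' => matching_from k.+1 opened w'
  | LParen :: w' => matching_from k.+1 (k :: opened) w'
  | RParen :: w' =>
      if opened is j :: opened' then (j, k) :: matching_from k.+1 opened' w'
      else matching_from k.+1 [::] w'
  end.

Definition matching (w : seq letter) : seq (nat * nat) :=
  matching_from 0 [::] w.

Definition theta_col (n : nat) (D : {set 'I_n * 'I_n}) (c : 'I_n)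
    (S : {set 'I_n}) : nat :=
  count is_star (word D c S) + size (matching (word D c S)).

Definition theta (n : nat) (D : {set 'I_n * 'I_n}) (S : {set 'I_n}) : nat :=
  \sum_(c < n) theta_col D c S.

Definition schubitope (R : realType) (n : nat) (D : {set 'I_n * 'I_n}) :
    set 'rV[R]_n :=
  [set a : 'rV[R]_n |
     [/\ (forall i, 0 <= a 0 i)%R,
         (\sum_(i < n) a 0 i = #|D|%:R)%R
       & forall S : {set 'I_n}, (\sum_(i in S) a 0 i <= (theta D S)%:R)%R]]%classic.

Arguments schubitope R {n} D.

Section Tableaux.
Variables (n : nat) (D : {set 'I_n * 'I_n}).

(* Maps from D to [n]; the domain is the subtype of boxes lying in D. *)
Definition filling := {ffun {b : 'I_n * 'I_n | b \in D} -> 'I_n}.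

Definition flagged (tau : filling) : bool :=
  [forall b, tau b <= (val b).1].

Definition column_injective (tau : filling) : bool :=
  [forall b, forall b',
     ((val b).2 == (val b').2) && ((val b).1 != (val b').1)
       ==> (tau b != tau b')].

Definition has_content (alpha : 'I_n -> nat) (tau : filling) : bool :=
  [forall i, #|tau @^-1: [set i]| == alpha i].

Definition PerfectTab (alpha : 'I_n -> nat) : {set filling} :=
  [set tau | [&& flagged tau, column_injective tau & has_content alpha tau]].

End Tableaux.

(* Main.v *)
(* A column c of D contributes a 0/1 vector, the indicator of the set of values
   of tau in that column; the sets that occur are those of size #D_c dominated
   componentwise by the set D_c of rows of column c.  Parenthesis matching gives
     theta_D^c(S) = min_k (#(S cap [1,k]) + #(D_c cap [k+1,n])),
   from which theta_D^c is submodular, and an integer vector b of total #D_c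
   with b(S) <= theta_D^c(S) for all S is the indicator of such a set.  So alpha
   in S_D has to be split into one vector per column, each bounded by its
   theta_D^c; this is done one column at a time by Frank's discrete sandwich
   theorem applied to theta_D^c and alpha minus the sum of the remaining ones. *)
Require Import Defs.
From mathcomp Require Import boolp classical_sets reals.
From mathcomp Require Import all_boot all_order all_algebra.
From mathcomp Require Import zify.

Set Implicit Arguments.
Unset Strict Implicit.
Unset Printing Implicit Defensive.

Import Order.TTheory GRing.Theory Num.Theory.

(** * Parenthesis matching and cuts of a word *)

Definition letter_at (T : finType) (A S : {set T}) (r : T) : option letter :=
  match r \in A, r \in S with
  | false, true => Some LParen
  | true, false => Some RParen
  | true, true => Some Star
  | false, false => None
  end.

(** The state of the matching is kept explicit for induction along the word; [theta_col] is the case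
    of position 0 and empty stack. *)
Definition word_weight (k : nat) (opened : seq nat) (w : seq letter) : nat :=
  count is_star w + size (matching_from k opened w).

Lemma word_weight_le_size (T : finType) (A S : {set T}) (s : seq T) k opened :
  word_weight k opened (pmap (letter_at A S) s) <= count (mem A) s.
Proof.
rewrite /word_weight; elim: s => [|x s IHs] //= in k opened *.
rewrite [letter_at A S x]/letter_at; case: (x \in A); case: (x \in S) => /=.
- by have := IHs k.+1 opened; lia.
- case: opened => [|j o] /=; first by have := IHs k.+1 [::]; lia.
  by have := IHs k.+1 o; lia.
- by have := IHs k.+1 (k :: opened); lia.
- by have := IHs k opened; lia.
Qed.

(** Cut after [j] rows. Stars and pairs whose right parenthesis comes after the cut are charged to
    rows of [A] there; any other star or pair is charged to its row of [S] before the cut, or to the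
    entry of the initial stack that it uses. *)
Lemma word_weight_le (T : finType) (A S : {set T}) (s : seq T) k opened j :
  word_weight k opened (pmap (letter_at A S) s) <=
    size opened + count (mem S) (take j s) + count (mem A) (drop j s).
Proof.
elim: s => [|x s IHs] //= in k opened j *.
case: j => [|j].
  have := word_weight_le_size A S (x :: s) k opened.
  by rewrite drop0 /=; lia.
move: IHs; rewrite /= /word_weight [letter_at A S x]/letter_at => IHs.
case: (x \in A); case: (x \in S) => /=.
- by have := IHs k.+1 opened j; lia.
- case: opened => [|i o] /=; first by have := IHs k.+1 [::] j => /=; lia.
  by have := IHs k.+1 o j; lia.
- by have := IHs k.+1 (k :: opened) j => /=; lia.
- by have := IHs k opened j; lia.
Qed.

(** The bound is attained just after the last unmatched right parenthesis: the stack is empty there,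
    so all earlier left parentheses are matched, and all later right ones are. If every right
    parenthesis is matched, all of [A] is counted; this case stays apart because the cut at 0 would
    add [size opened]. *)
Lemma word_weight_eq (T : finType) (A S : {set T}) (s : seq T) k opened :
  word_weight k opened (pmap (letter_at A S) s) = count (mem A) s \/
  exists j, word_weight k opened (pmap (letter_at A S) s) =
    size opened + count (mem S) (take j s) + count (mem A) (drop j s).
Proof.
elim: s => [|x s IHs] /= in k opened *; first by left.
move: IHs; rewrite /word_weight [letter_at A S x]/letter_at => IHs.
case: (boolP (x \in A)) => xA; case: (boolP (x \in S)) => xS /=.
- case: (IHs k.+1 opened) => [e|[j e]]; first by left; lia.
  by right; exists j.+1; rewrite /= xS; lia.
- case: opened => [|i o] /=.
    case: (IHs k.+1 [::]) => [e|[j e]].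
      (* The first row is itself the last unmatched right parenthesis. *)
      by right; exists 1; rewrite /= (negPf xS) take0 drop0 /=; lia.
    by right; exists j.+1; rewrite /= (negPf xS); move: e => /=; lia.
  case: (IHs k.+1 o) => [e|[j e]]; first by left; lia.
  by right; exists j.+1; rewrite /= (negPf xS); lia.
- case: (IHs k.+1 (k :: opened)) => [e|[j e]]; first by left; lia.
  by right; exists j.+1; rewrite /= xS; move: e => /=; lia.
- case: (IHs k opened) => [e|[j e]]; first by left; lia.
  by right; exists j.+1; rewrite /= (negPf xS); lia.
Qed.

(** * The minimum formula for [theta_col] and its submodularity *)

Definition column (n : nat) (D : {set 'I_n * 'I_n}) (c : 'I_n) : {set 'I_n} :=
  [set r | (r, c) \in D].

Definition truncation (n : nat) (A : {set 'I_n}) (k : nat) (S : {set 'I_n}) :=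
  #|[set i in S | i < k]| + #|[set i in A | k <= i]|.

Lemma take_enum_ord n k :
  take k (enum 'I_n) = [seq i : 'I_n <- enum 'I_n | i < k].
Proof.
apply: (inj_map val_inj).
rewrite map_take -(filter_map val (fun i => i < k)) val_enum_ord take_iota.
case: (leqP k n) => kn; first by rewrite (filter_iota_ltn 0).
rewrite -[LHS](filter_iota_ltn 0 (leqnn n)); apply: eq_in_filter => i.
by rewrite mem_iota; lia.
Qed.

Lemma drop_enum_ord n k :
  drop k (enum 'I_n) = [seq i : 'I_n <- enum 'I_n | k <= i].
Proof.
apply: (inj_map val_inj).
rewrite map_drop -(filter_map val (fun i => k <= i)) val_enum_ord drop_iota.
case: (leqP k n) => kn.
  rewrite -{2}(subnKC kn) iotaD filter_cat (@eq_in_filter _ _ pred0).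
    rewrite filter_pred0 /= -[LHS]filter_predT; apply: eq_in_filter => i.
    by rewrite mem_iota /=; lia.
  by move=> i; rewrite mem_iota /=; lia.
rewrite (@eq_in_filter _ _ pred0) ?filter_pred0; last first.
  by move=> i; rewrite mem_iota /=; lia.
by have -> : n - k = 0 by lia.
Qed.

Lemma truncation_enum n (A S : {set 'I_n}) k :
  truncation A k S =
  count (mem S) (take k (enum 'I_n)) + count (mem A) (drop k (enum 'I_n)).
Proof.
have count_card (B : {set 'I_n}) (P : pred 'I_n) :
    #|[set i in B | P i]| = count (mem B) [seq i : 'I_n <- enum 'I_n | P i].
  by rewrite count_filter -size_filter cardE enumT; congr size;
    apply: eq_filter => i; rewrite !inE.
by rewrite take_enum_ord drop_enum_ord -!count_card.
Qed.

Lemma theta_colE n (D : {set 'I_n * 'I_n}) c S :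
  theta_col D c S =
  word_weight 0 [::] (pmap (letter_at (column D c) S) (enum 'I_n)).
Proof.
rewrite /theta_col /word; suff -> : pmap (letter_at (column D c) S) (enum 'I_n) =
  word D c S by [].
by apply: eq_pmap => r; rewrite /letter_at inE.
Qed.

Lemma theta_col_le n (D : {set 'I_n * 'I_n}) c S k :
  theta_col D c S <= truncation (column D c) k S.
Proof. by rewrite theta_colE truncation_enum word_weight_le. Qed.

Lemma theta_col_eq n (D : {set 'I_n * 'I_n}) c S :
  exists k, theta_col D c S = truncation (column D c) k S.
Proof.
rewrite theta_colE.
case: (word_weight_eq (column D c) S (enum 'I_n) 0 [::]) => [->|[k ->]].
  by exists 0; rewrite truncation_enum take0 drop0.
by exists k; rewrite truncation_enum.
Qed.

(** The smaller cut goes with the union: the rows below [k] then balance, and a row in [[k, l)]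
    counts on the left only if it lies in both sets, on the right as soon as it lies in [T]. *)
Lemma truncation_submodular n (A S T : {set 'I_n}) k l : k <= l ->
  truncation A k (S :|: T) + truncation A l (S :&: T) <=
  truncation A k S + truncation A l T.
Proof.
move=> kl; rewrite /truncation.
suff : #|[set i in S :|: T | i < k]| + #|[set i in S :&: T | i < l]| <=
       #|[set i in S | i < k]| + #|[set i in T | i < l]| by lia.
rewrite -!sum1dep_card !(big_mkcond (fun i => _ && _)) -!big_split /=.
apply: leq_sum => i _; rewrite !inE.
by case: (i \in S); case: (i \in T); case: (ltnP i k); case: (ltnP i l) => //=; lia.
Qed.

Lemma theta_col_submodular n (D : {set 'I_n * 'I_n}) c (S T : {set 'I_n}) :
  theta_col D c (S :|: T) + theta_col D c (S :&: T) <=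
  theta_col D c S + theta_col D c T.
Proof.
(* The claim is symmetric in [S] and [T], so the minimizing cuts may be taken in order. *)
wlog : S T / exists k l, [/\ k <= l, theta_col D c S = truncation (column D c) k S
    & theta_col D c T = truncation (column D c) l T].
  move=> IH; have [k eS] := theta_col_eq D c S; have [l eT] := theta_col_eq D c T.
  case: (leqP k l) => kl; first by apply: IH; exists k, l.
  rewrite setUC setIC addnC [X in _ <= X]addnC addnC.
  by apply: IH; exists l, k; rewrite ltnW.
move=> [k [l [kl -> ->]]].
apply: leq_trans (truncation_submodular (column D c) S T kl).
by apply: leq_add; apply: theta_col_le.
Qed.

(** * From domination to a flagged injection *)

(** Match the largest elements [a] of [A] and [t] of [T]; the threshold [t] forces [t <= a].
    Domination survives their removal: thresholds up to [t] lose one element on each side, and no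
    element of [T] lies above [t]. *)
Lemma dominated_bijection n (A T : {set 'I_n}) :
  #|T| = #|A| ->
  (forall k, #|[set i in T | k <= i]| <= #|[set i in A | k <= i]|) ->
  exists g : 'I_n -> 'I_n,
    [/\ {in A &, injective g}, g @: A = T & {in A, forall r, g r <= r}].
Proof.
move: {2}#|A| (erefl #|A|) => m; elim: m => [|m IHm] in A T *.
  move=> cA; rewrite cA => /cards0_eq -> _; move/cards0_eq: cA => ->.
  by exists id; split=> [x y|| x]; rewrite ?inE ?imset0.
move=> cA cT dom.
have [a0 a0A] : exists a, a \in A by apply/set0Pn; rewrite -card_gt0 cA.
have [t0 t0T] : exists t, t \in T by apply/set0Pn; rewrite -card_gt0 cT cA.
case: (arg_maxnP (fun i : 'I_n => i : nat) a0A) => a aA amax.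
case: (arg_maxnP (fun i : 'I_n => i : nat) t0T) => t tT tmax.
have {}aA : a \in A := aA; have {}tT : t \in T := tT.
have ta : t <= a.
  have : 0 < #|[set i in A | t <= i]|.
    by apply: leq_trans (dom t); apply/card_gt0P; exists t; rewrite !inE tT /=.
  case/card_gt0P=> i; rewrite !inE => /andP [iA ti].
  exact: leq_trans ti (amax _ iA).
have cA' := cardsD1 a A; have cT' := cardsD1 t T.
rewrite aA cA add1n in cA'; rewrite tT cT cA add1n in cT'.
case: cA' => cA'; case: cT' => cT'.
have [||g [ginj gim gle]] := IHm (A :\ a) (T :\ t) (esym cA').
- by rewrite -cT' -cA'.
- move=> k; case: (leqP k t) => kt; last first.
    rewrite (_ : [set i in T :\ t | k <= i] = set0) ?cards0 //.
    apply/setP=> i; rewrite !inE; apply/negP=> /andP [/andP [_ /tmax]]; lia.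
  have sepD (B : {set 'I_n}) b :
      [set i in B | k <= i] :\ b = [set i in B :\ b | k <= i].
    by apply/setP=> i; rewrite !inE andbA.
  have := dom k.
  rewrite (cardsD1 t [set i in T | _]) (cardsD1 a [set i in A | _]) !sepD.
  by rewrite !inE aA tT kt (leq_trans kt ta) leq_add2l.
exists (fun x => if x == a then t else g x).
have gT x : x \in A -> x != a -> g x \in T :\ t.
  by move=> xA xa; rewrite -gim imset_f // !inE xa.
split=> [x y xA yA||x xA].
- case: eqVneq => [->|xa]; case: eqVneq => [->|ya] //.
  + by move=> e; move: (gT _ yA ya); rewrite -e setD11.
  + by move=> e; move: (gT _ xA xa); rewrite e setD11.
  + by apply: ginj; rewrite !inE ?xa ?ya.
- rewrite -{1}(setD1K aA) imsetU1 eqxx -(setD1K tT) -gim; congr (_ |: _).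
  by apply: eq_in_imset => x; rewrite !inE => /andP [/negPf ->].
- by case: eqVneq => [->|xa] //; apply: gle; rewrite !inE xa.
Qed.

(** * Submodular functions and the sandwich theorem *)

Definition submodular_on (T : finType) (V : {set T}) (f : {set T} -> int) :=
  forall X Y : {set T}, X \subset V -> Y \subset V ->
    (f (X :|: Y) + f (X :&: Y) <= f X + f Y)%R.

Lemma setU1_I_notin (T : finType) (s : T) (X Y : {set T}) :
  s \notin Y -> (s |: X) :&: Y = X :&: Y.
Proof.
move=> sY; apply/setP=> i; rewrite !inE; case: eqVneq => [->|//].
by rewrite (negPf sY) !andbF.
Qed.

(** Whichever terms realize the two minima on the right, uncross the corresponding sets, with or
    without [s]. Union and intersection contain [s] as many times in total, so the multiples of [t]
    agree. *)
Lemma submodular_on_minor (T : finType) (W : {set T}) (s : T) (t : int)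
    (f : {set T} -> int) :
  s \notin W -> submodular_on (s |: W) f ->
  submodular_on W (fun X => Num.min (f X) (f (s |: X) - t))%R.
Proof.
move=> sW fsub X Y sX sY.
have sX' := subset_trans sX (subsetU1 s W).
have sY' := subset_trans sY (subsetU1 s W).
have h1 := fsub X Y sX' sY'.
have h2 := fsub (s |: X) Y (setUS [set s] sX) sY'.
have h3 := fsub X (s |: Y) sX' (setUS [set s] sY).
have h4 := fsub (s |: X) (s |: Y) (setUS [set s] sX) (setUS [set s] sY).
have sXn : s \notin X by apply: contraNN sW; apply: (subsetP sX).
have sYn : s \notin Y by apply: contraNN sW; apply: (subsetP sY).
move: h2 h3 h4.
rewrite -setUA (setU1_I_notin _ sYn) (setUCA X [set s] Y).
rewrite (setIC X (s |: Y)) (setU1_I_notin _ sXn) -setUUr -setUIr.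
rewrite [Y :&: X]setIC !minEle.
by case: ifP; case: ifP; case: ifP; case: ifP; lia.
Qed.

(* The value t of m at a new element s is chosen so that, after deleting s, the
   functions max (p X, p (X + s) - t) and min (f X, f (X + s) - t) still bound a
   modular function; the admissible interval for t is nonempty by uncrossing. *)
Lemma discrete_sandwich (T : finType) (V : {set T}) (f p : {set T} -> int) :
  submodular_on V f -> submodular_on V (fun X => - p X)%R ->
  f set0 = 0%R -> p set0 = 0%R ->
  (forall X : {set T}, X \subset V -> (p X <= f X)%R) ->
  exists m : T -> int, forall X : {set T}, X \subset V ->
    (p X <= \sum_(i in X) m i <= f X)%R.
Proof.
move: {2}#|V| (erefl #|V|) => k; elim: k => [|k IHk] in V f p *.
  move/cards0_eq => -> _ _ f0 p0 _; exists (fun=> 0%R) => X.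
  by rewrite subset0 => /eqP ->; rewrite big_set0 f0 p0 lexx.
move=> cV fsub psup f0 p0 lepf.
have /set0Pn [s sV] : V != set0 by rewrite -card_gt0 cV.
have [W sW eV] : exists2 W : {set T}, s \notin W & V = s |: W.
  by exists (V :\ s); rewrite ?setD11 ?setD1K.
subst V.
have cW : #|W| = k by move: cV; rewrite cardsU1 sW => -[].
(* Submodularity of [f] at [s |: Y], [X] and supermodularity of [p] at [s |: X], [Y] lead to the
   same union and intersection, where [p <= f] applies. *)
have uncross (X Y : {set T}) : X \subset W -> Y \subset W ->
    (p (s |: X) - f X <= f (s |: Y) - p Y)%R.
  move=> sX sY.
  have sX' := subset_trans sX (subsetU1 s W).
  have sY' := subset_trans sY (subsetU1 s W).
  have sYn : s \notin Y by apply: contraNN sW; apply: (subsetP sY).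
  have sXn : s \notin X by apply: contraNN sW; apply: (subsetP sX).
  have := psup (s |: X) Y (setUS [set s] sX) sY'.
  have := fsub (s |: Y) X (setUS [set s] sY) sX'.
  rewrite -!setUA !setU1_I_notin // [Y :|: X]setUC [Y :&: X]setIC.
  have := lepf (s |: (X :|: Y)) _; have := lepf (X :&: Y) _.
  rewrite setUS ?subUset ?sX // (subset_trans (subsetIl _ _)) //.
  move=> /(_ isT) + /(_ isT); lia.
have [t tge tle] : exists2 t : int,
    forall X : {set T}, X \subset W -> (p (s |: X) - f X <= t)%R &
    forall Y : {set T}, Y \subset W -> (t <= f (s |: Y) - p Y)%R.
  have := @arg_maxP _ _ _ set0 (fun X : {set T} => X \subset W)
    (fun X => p (s |: X) - f X)%R (sub0set W).
  case=> X0 sX0 X0max; exists (p (s |: X0) - f X0)%R => [X|Y] sub.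
    exact: X0max.
  exact: uncross.
pose f' X := Num.min (f X) (f (s |: X) - t)%R.
pose p' X := Num.max (p X) (p (s |: X) - t)%R.
have [||||X sX|m mP] := IHk W f' p' cW.
- exact: submodular_on_minor.
(* Negation turns the maximum defining [p'] into the minor of [- p] with parameter [- t]. *)
- have := submodular_on_minor (- t)%R sW psup.
  move=> h X Y sX sY; have := h X Y sX sY; rewrite /p' /= !minEle !maxEle.
  by do !case: ifP; lia.
- have := tle set0 (sub0set _); rewrite /f' f0 p0 minEle; case: ifP; lia.
- have := tge set0 (sub0set _); rewrite /p' f0 p0 maxEle; case: ifP; lia.
- have := lepf X (subset_trans sX (subsetU1 s W)).
  have := lepf (s |: X) (setUS [set s] sX).
  have := tle X sX; have := tge X sX.
  rewrite /f' /p' minEle maxEle; do !case: ifP; lia.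
exists (fun i => if i == s then t else m i) => X sX.
have msum (Y : {set T}) : Y \subset W ->
    (\sum_(i in Y) (if i == s then t else m i) = \sum_(i in Y) m i)%R.
  move=> sY; apply: eq_bigr => i iY; case: eqVneq => // eis.
  by move: sW; rewrite -eis (subsetP sY).
have sXW : X :\ s \subset W by rewrite subDset.
have := mP _ sXW; rewrite /p' /f' ge_max le_min.
case/andP=> /andP [pX psX] /andP [fX fsX].
case: (boolP (s \in X)) => sinX.
  rewrite -(setD1K sinX) big_setU1 ?setD11 //= eqxx msum //.
  by rewrite -lerBlDl psX -lerBrDl fsX.
have eX : X :\ s = X by apply/setDidPl; rewrite disjoint_sym disjoints1.
by rewrite eX in sXW pX fX; rewrite msum // pX fX.
Qed.

(** Only an inequality [a <= \sum b] is carried through the induction, which makes the empty list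
    harmless; equality is recovered later by comparing totals. *)
Lemma submodular_sum_split (T : finType) (I : eqType) (cs : seq I)
    (f : I -> {set T} -> int) (a : T -> int) :
  uniq cs -> (forall c, submodular_on [set: T] (f c)) ->
  (forall c, f c set0 = 0%R) ->
  (forall X : {set T}, \sum_(i in X) a i <= \sum_(c <- cs) f c X)%R ->
  exists b : I -> T -> int,
    (forall i, a i <= \sum_(c <- cs) b c i)%R /\
    {in cs, forall c (X : {set T}), (\sum_(i in X) b c i <= f c X)%R}.
Proof.
move=> + fsub f0; elim: cs => [|c cs IHcs] /= in a *.
  move=> _ le_a; exists (fun _ _ => 0%R); split=> // i.
  by have := le_a [set i]; rewrite big_set1 !big_nil.
move=> /andP [ccs ucs] le_a.
have rsub (X Y : {set T}) : (\sum_(d <- cs) f d (X :|: Y) +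
    \sum_(d <- cs) f d (X :&: Y) <=
    \sum_(d <- cs) f d X + \sum_(d <- cs) f d Y)%R.
  by rewrite -!big_split /=; apply: ler_sum => d _; apply: fsub; apply: subsetT.
have asum (X Y : {set T}) : (\sum_(i in X :|: Y) a i + \sum_(i in X :&: Y) a i
    = \sum_(i in X) a i + \sum_(i in Y) a i)%R.
  rewrite !(big_mkcond (fun i => i \in _)) -!big_split /=.
  apply: eq_bigr => i _; rewrite !inE.
  by case: (i \in X); case: (i \in Y); rewrite ?addr0 ?add0r.
have [|||X _|m mP] := @discrete_sandwich T [set: T] (f c)
    (fun X => \sum_(i in X) a i - \sum_(d <- cs) f d X)%R (fsub c).
- by move=> X Y _ _; have := rsub X Y; have := asum X Y; lia.
- exact: f0.
- by rewrite big_set0 big1 // subr0.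
- by have := le_a X; rewrite big_cons lerBlDr.
(* The lower half of the sandwich for [m] says exactly that [a - m] is bounded by the remaining
   functions. *)
have [X|b [le_b bP]] := IHcs (fun i => a i - m i)%R ucs.
  have /andP [+ _] := mP X (subsetT X).
  by rewrite big_split /= sumrN lerBlDr lerBlDl.
exists (fun d => if d == c then m else b d); split=> [i|d].
  rewrite big_cons eqxx (eq_big_seq (fun d => b d i)) => [|d dcs].
    by rewrite -lerBlDl; apply: le_b.
  by case: eqVneq dcs => // ->; rewrite (negPf ccs).
rewrite inE; case: eqVneq => [-> _ X|_ /= dcs]; last exact: bP.
by have /andP [] := mP X (subsetT X).
Qed.

Lemma sum_le_eq (R : numDomainType) (I : finType) (a b : I -> R) :
  (forall i, a i <= b i)%R -> (\sum_i b i <= \sum_i a i)%R ->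
  forall i, a i = b i.
Proof.
move=> le_ab le_ba i; apply/eqP; rewrite eq_sym -subr_eq0; apply/eqP.
have ge0 j : true -> (0 <= b j - a j)%R by rewrite subr_ge0.
apply: (psumr_eq0P ge0) => //; apply/eqP; rewrite big_split /= sumrN.
by rewrite subr_eq0 eq_le le_ba ler_sum.
Qed.

(** * Tableaux read column by column *)

Lemma sum_columns n (D : {set 'I_n * 'I_n}) (F : 'I_n * 'I_n -> nat) :
  \sum_(b in D) F b = \sum_(c < n) \sum_(r in column D c) F (r, c).
Proof.
rewrite pair_big_dep /= (reindex (fun p => (p.2, p.1))) /=.
  by apply: eq_bigl => p; rewrite inE.
by exists (fun p => (p.2, p.1)) => -[].
Qed.

Lemma sum_eq_mem (T : finType) (A : {set T}) i : \sum_(j in A) (j == i) = (i \in A).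
Proof.
case: (boolP (i \in A)) => iA.
  rewrite (bigD1 i) //= eqxx big1 // => j /andP [_ /negPf ->] //.
by rewrite big1 // => j jA; case: eqVneq jA iA => // -> ->.
Qed.

(** Total functions [g c] replace the map on the subtype of boxes. By injectivity a column contains
    each value at most once, so the content is a sum of indicators of images. *)
Lemma PerfectTab_columns n (D : {set 'I_n * 'I_n}) (alpha : 'I_n -> nat) :
  PerfectTab D alpha != set0 <->
  exists g : 'I_n -> 'I_n -> 'I_n,
    [/\ forall c, {in column D c &, injective (g c)},
        forall c, {in column D c, forall r, g c r <= r}
      & forall i, alpha i = \sum_(c < n) (i \in g c @: column D c)].
Proof.
have content (g : 'I_n -> 'I_n -> 'I_n) (tau : filling D) i :
    (forall c, {in column D c &, injective (g c)}) ->
    (forall b, tau b = g (val b).2 (val b).1) ->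
    #|tau @^-1: [set i]| = \sum_(c < n) (i \in g c @: column D c).
  move=> ginj tauE; rewrite -sum1dep_card big_mkcond /=.
  rewrite (eq_bigr (fun b => (g (val b).2 (val b).1 == i) : nat)); last first.
    by move=> b _; rewrite !inE tauE; case: eqP.
  rewrite -(big_sub _ (fun b => (g b.2 b.1 == i) : nat)) sum_columns /=.
  apply: eq_bigr => c _; rewrite -sum_eq_mem big_imset //=; exact: ginj.
split.
- case/set0Pn=> tau; rewrite inE => /and3P [/forallP fl /forallP inj /forallP ct].
  (* Outside [D] the value [r] is a default; the conditions on [g c] concern rows of [column D c]
     only. *)
  pose g c r := if insub (r, c) is Some b then tau b else r.
  have tauE b : tau b = g (val b).2 (val b).1.
    by rewrite /g -surjective_pairing valK.
  have gE c r (h : (r, c) \in D) : g c r = tau (Sub (r, c) h).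
    by rewrite tauE.
  have ginj c : {in column D c &, injective (g c)}.
    move=> r r'; rewrite !inE => h h'; rewrite !gE => e.
    apply/eqP; move/forallP/(_ (Sub (r', c) h')): (inj (Sub (r, c) h)).
    by rewrite e !eqxx /=; case: eqP.
  exists g; split=> // [c r|i].
    by rewrite inE => h; rewrite gE; apply: (fl (Sub (r, c) h)).
  by rewrite -(content _ _ _ ginj tauE); apply/esym/eqP.
- case=> g [ginj gle ct]; apply/set0Pn.
  have tauE b : [ffun b : {b | b \in D} => g (val b).2 (val b).1] b =
      g (val b).2 (val b).1 by rewrite ffunE.
  exists [ffun b : {b | b \in D} => g (val b).2 (val b).1].
  rewrite inE; apply/and3P; split.
  + apply/forallP=> -[[r c] h]; rewrite ffunE /=.
    by apply: gle; rewrite inE.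
  + apply/forallP=> -[[r c] h]; apply/forallP=> -[[r' c'] h'].
    rewrite !ffunE /=; apply/implyP=> /andP [/eqP ecc rr']; subst c'.
    by apply: contraNneq rr' => e; apply/eqP; apply: (ginj c) e; rewrite inE.
  + apply/forallP=> i; apply/eqP.
    by rewrite (content _ _ _ ginj tauE) ct.
Qed.

(** * Column value sets and the bounds by [theta_col] *)

Lemma sum_content n (A : 'I_n -> {set 'I_n}) (alpha : 'I_n -> nat) (S : {set 'I_n}) :
  (forall i, alpha i = \sum_(c < n) (i \in A c)) ->
  \sum_(i in S) alpha i = \sum_(c < n) #|[set i in A c | i \in S]|.
Proof.
move=> aE; rewrite (eq_bigr _ (fun i _ => aE i)) exchange_big /=.
apply: eq_bigr => c _; rewrite -sum1dep_card big_mkcond [RHS]big_mkcond /=.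
by apply: eq_bigr => i _; case: (i \in S); case: (i \in A c).
Qed.

(** Since [g r <= r], a value at least [k] comes from a row at least [k]; the other values lie in
    [S] below [k]. *)
Lemma card_image_truncation n (A S : {set 'I_n}) (g : 'I_n -> 'I_n) k :
  {in A, forall r, g r <= r} -> #|[set i in g @: A | i \in S]| <= truncation A k S.
Proof.
move=> gle; apply: leq_trans (_ : #|[set i in S | i < k] :|:
    g @: [set i in A | k <= i]| <= _).
  apply/subset_leq_card/subsetP=> i; rewrite !inE => /andP [/imsetP [r rA ->] ->] /=.
  case: ltnP => //= kg; apply/imsetP; exists r => //.
  by rewrite inE rA (leq_trans kg) ?gle.
by rewrite (leq_trans (leq_card_setU _ _)) // leq_add2l leq_imset_card.
Qed.

Lemma truncation0 n (A S : {set 'I_n}) : truncation A 0 S = #|A|.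
Proof.
rewrite /truncation (_ : [set i in S | i < 0] = set0) ?cards0 ?add0n.
  by apply: eq_card => i; rewrite inE andbT.
by apply/setP=> i; rewrite !inE andbF.
Qed.

Lemma truncation_size n (A S : {set 'I_n}) : truncation A n S = #|S|.
Proof.
rewrite /truncation (_ : [set i in A | n <= i] = set0) ?cards0 ?addn0.
  by apply: eq_card => i; rewrite inE ltn_ord andbT.
by apply/setP=> i; rewrite !inE leqNgt ltn_ord andbF.
Qed.

Lemma card_columns n (D : {set 'I_n * 'I_n}) : #|D| = \sum_(c < n) #|column D c|.
Proof.
by rewrite -sum1_card sum_columns; apply: eq_bigr => c _; rewrite sum1_card.
Qed.

(* Since b is dominated by theta, which is at most 1 on singletons, b <= 1; since
   moreover b has the largest possible total, b >= 0. *)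
Lemma theta_col_base n (D : {set 'I_n * 'I_n}) c (b : 'I_n -> int) :
  (forall S : {set 'I_n}, \sum_(i in S) b i <= Posz (theta_col D c S))%R ->
  (\sum_i b i = Posz #|column D c|)%R ->
  exists A : {set 'I_n}, (forall i, b i = Posz (i \in A)) /\
    forall S : {set 'I_n}, #|[set i in A | i \in S]| <= theta_col D c S.
Proof.
move=> le_b sum_b.
have b01 i : (0 <= b i <= 1)%R.
  (* The cut at 0 bounds the sum over [[set~ i]] by the whole total, so [b i >= 0]; the cut at [n]
     bounds [b i] by 1. *)
  have := le_b [set i]; have := le_b [set~ i].
  have := theta_col_le D c [set~ i] 0; have := theta_col_le D c [set i] n.
  rewrite truncation0 truncation_size cards1 big_set1.
  move: sum_b; rewrite (bigD1 i) //=.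
  have -> : (\sum_(j | j != i) b j = \sum_(j in [set~ i]) b j)%R.
    by apply: eq_bigl => j; rewrite !inE.
  move: (\sum_(j in _) b j)%R => x; lia.
have bE i : b i = Posz (i \in [set j | b j == 1%R]).
  by rewrite inE; case: eqP => //; have := b01 i; lia.
exists [set i | b i == 1%R]; split=> // S.
rewrite -lez_nat; apply: le_trans (le_b S).
rewrite (eq_bigr _ (fun i _ => bE i)) -(big_morph Posz PoszD (erefl _)).
rewrite lez_nat -sum1dep_card big_mkcond [X in _ <= X]big_mkcond /=.
by apply: leq_sum => i _; case: (i \in S); case: (i \in _).
Qed.

(** * The criterion over the integers, then over the reals *)

Lemma PerfectTab_theta n (D : {set 'I_n * 'I_n}) (alpha : 'I_n -> nat) :
  PerfectTab D alpha != set0 <->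
  \sum_i alpha i = #|D| /\
  forall S : {set 'I_n}, \sum_(i in S) alpha i <= theta D S.
Proof.
rewrite PerfectTab_columns; split=> [[g [ginj gle ct]]|[tot le_theta]].
  split=> [|S].
    rewrite (eq_bigl (fun i => i \in [set: 'I_n])) => [|i]; last by rewrite !inE.
    rewrite (sum_content _ ct) card_columns; apply: eq_bigr => c _.
    rewrite -(card_in_imset (ginj c)); apply: eq_card => i.
    by rewrite inE in_setT andbT.
  rewrite (sum_content _ ct); apply: leq_sum => c _.
  have [k ->] := theta_col_eq D c S.
  exact/card_image_truncation/gle.
have fsub c : submodular_on [set: 'I_n] (fun S => Posz (theta_col D c S)).
  by move=> X Y _ _; rewrite -!PoszD lez_nat theta_col_submodular.
have f0 c : Posz (theta_col D c set0) = 0%R.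
  by have := theta_col_le D c set0 n; rewrite truncation_size cards0; lia.
have sumZ (I : finType) (P : pred I) (F : I -> nat) :
    (Posz (\sum_(i | P i) F i) = \sum_(i | P i) Posz (F i))%R.
  exact: (big_morph Posz PoszD).
have le_f (X : {set 'I_n}) :
    (\sum_(i in X) Posz (alpha i) <= \sum_c Posz (theta_col D c X))%R.
  by rewrite -!sumZ lez_nat le_theta.
have [b [le_b bP]] :=
  submodular_sum_split (index_enum_uniq _) fsub f0 le_f.
have le_card c : (\sum_i b c i <= Posz #|column D c|)%R.
  rewrite (eq_bigl (fun i => i \in [set: 'I_n])) => [|i]; last by rewrite !inE.
  apply: le_trans (bP c (mem_index_enum c) _) _.
  by rewrite lez_nat -(truncation0 _ [set: 'I_n]) theta_col_le.
have card_sum : (\sum_c Posz #|column D c| = \sum_i Posz (alpha i))%R.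
  by rewrite -!sumZ -card_columns tot.
(* The total of [alpha] is at most that of [b], which is at most the sum of the column sizes, again
   the total of [alpha]; hence [le_card] and [le_b] are equalities throughout. *)
have sum_b c : (\sum_i b c i = Posz #|column D c|)%R.
  apply: (sum_le_eq le_card); rewrite card_sum exchange_big.
  by apply: ler_sum => i _; apply: le_b.
have alphaE i : Posz (alpha i) = (\sum_c b c i)%R.
  apply: (sum_le_eq le_b); rewrite exchange_big -card_sum.
  by apply: ler_sum => c _; apply: le_card.
have [A AP] := fin_all_exists (fun c =>
  theta_col_base (bP c (mem_index_enum c)) (sum_b c)).
have cardA c : #|A c| = #|column D c|.
  have [bE _] := AP c; apply/eqP; rewrite -eqz_nat -sum_b -sum1_card sumZ.
  rewrite big_mkcond; apply/eqP/eq_bigr => i _.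
  by rewrite bE; case: (i \in A c).
(* Test the bound on the set of all rows at least [k]: the cut at [k] leaves no contribution from
   that set, only the rows of the column from [k] on. *)
have domA c k : #|[set i in A c | k <= i]| <= #|[set i in column D c | k <= i]|.
  have [_ leA] := AP c; have := leA [set i : 'I_n | k <= i].
  have := theta_col_le D c [set i : 'I_n | k <= i] k.
  rewrite /truncation (_ : [set i : 'I_n in _ | i < k] = set0) ?cards0 ?add0n.
    move=> h1 h2; apply: leq_trans (leq_trans h2 h1).
    by apply/eq_leq/eq_card=> i; rewrite !inE.
  by apply/setP=> i; rewrite !inE ltnNge andbN.
have [g gP] := fin_all_exists (fun c => dominated_bijection (cardA c) (domA c)).
exists g; split=> [c|c|i]; try by case: (gP c).
apply/eqP; rewrite -eqz_nat alphaE sumZ; apply/eqP/eq_bigr => c _.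
by have [_ -> _] := gP c; have [-> _] := AP c.
Qed.

Theorem theorem2p13 (R : realType) (n : nat) (D : {set 'I_n * 'I_n})
    (alpha : 'I_n -> nat) :
  schubitope R D (\row_(i < n) (alpha i)%:R)%R <->
  PerfectTab D alpha != finset.set0.
Proof.
(* Every sum involved is a natural number cast into [R], so the real conditions are equivalent to
   those in [nat]. *)
have rowE (P : pred 'I_n) :
    (\sum_(i | P i) (\row_(j < n) (alpha j)%:R : 'rV[R]_n) 0 i =
     (\sum_(i | P i) alpha i)%:R)%R.
  by rewrite natr_sum; apply: eq_bigr => i _; rewrite mxE.
rewrite PerfectTab_theta; split=> [[_ tot le_theta]|[tot le_theta]]; split.
- by apply/eqP; rewrite -(eqr_nat R) -tot rowE.
- by move=> S; rewrite -(ler_nat R) -rowE.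
- by move=> i; rewrite mxE ler0n.
- by rewrite rowE tot.
- by move=> S; rewrite rowE ler_nat.
Qed.
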